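(* Let $D\in\mathbb{K}^{m\times n}$ be a matrix over a field $\mathbb{K}$. Let $\mathcal{R}^{-1}$ and $\overline{\mathcal{R}}$ be the matrices returned on input $D$ by Algorithm I and Algorithm II of the context, respectively, and let $\rho=(\rho_1<\dots<\rho_k)$ denote the indices of the pivot rows of the elimination procedure in Algorithm I. Then $\overline{\mathcal{R}}=(\mathcal{R}^{-1})_{\rho\rho}$.
   Context: For index sequences $\sigma,\tau$, $B_{\sigma\tau}$ is the submatrix of $B$ with rows $\sigma$ and columns $\tau$; $\mathbf{n}=(1,\dots,n)$. The leading entry of a nonzero row is its first (leftmost) nonzero entry. Algorithm I (uncompressed). Let $B$ be a working copy of $D$. Initialize $L\gets I^{m\times m}$. For $i=m,m-1,\dots,1$: while there exist $j\in\{i+1,\dots,m\}$ and $k\in\{1,\dots,n\}$ such that $\mathrm{row}_i(B)$ and $\mathrm{row}_j(B)$ both have their leading nonzero entry in column $k$, set, with $\lambda=B[i,k]/B[j,k]$, $\mathrm{row}_i(B)\gets\mathrm{row}_i(B)-\lambda\,\mathrm{row}_j(B)$ and $\mathrm{row}_i(L)\gets\mathrm{row}_i(L)-\lambda\,\mathrm{row}_j(L)$. Return $\mathcal{R}^{-1}=L$. The pivot rows are those indices $i$ for which $\mathrm{row}_i(B)\ne0$ at termination (equivalently $\mathrm{row}_i(\mathcal{R}^{-1}D)\neq0$). Algorithm II (compressed). Maintain a strictly increasing list $\mathrm{ind}$ of row indices (initially empty), a square matrix $\overline{\mathcal{R}}$ with rows and columns numbered by positions in $\mathrm{ind}$ (initially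 the empty matrix), and $M\in\mathbb{K}^{m\times n}$ (initially $0$). For $i=m,m-1,\dots,1$: set $v\gets0\in\mathbb{K}^{1\times|\mathrm{ind}|}$ and $w\gets\mathrm{row}_i(D)$. While $w\ne0$ and, with $k$ the column of the first nonzero entry of $w$, there is a position $l$ such that $j=\mathrm{ind}[l]$ satisfies $M[j,k]\neq0$: set $\lambda=w[k]/M[j,k]$, $w\gets w-\lambda\,\mathrm{row}_l(\overline{\mathcal{R}})\cdot D_{\mathrm{ind},\mathbf{n}}$, and $v\gets v-\lambda\,\mathrm{row}_l(\overline{\mathcal{R}})$. After the loop, if $w\ne0$, let $k$ be the column of its first nonzero entry, set $\overline{\mathcal{R}}\gets\begin{bmatrix}1&v\\0&\overline{\mathcal{R}}\end{bmatrix}$, $M[i,k]\gets w[k]$, and insert $i$ at the front of $\mathrm{ind}$. Return $\overline{\mathcal{R}}$ and $M$. *)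

(* Defs.v *)
From mathcomp Require Import all_boot all_order all_algebra.
From mathcomp Require Import zify.

Set Implicit Arguments.
Unset Strict Implicit.
Unset Printing Implicit Defensive.

Import GRing.Theory.
Local Open Scope ring_scope.

(* Indices are 0-based: row i of the mathematical text is row i-1 here.       *)

(* Big-step semantics of imperative loops.  The loop bodies below leave the   *)
(* choice of indices open, so a program is a relation between states and      *)
(* every admissible sequence of choices counts as a run.                      *)

(* "while there exist parameters satisfying the guard, update the state":     *)
(* [step s s'] combines guard and update, and the loop exits exactly when no  *)
(* step is possible.                                                          *)
Inductive while_loop (S : Type) (step : S -> S -> Prop) : S -> S -> Prop :=
| while_exit s : (forall s', ~ step s s') -> while_loop step s s
| while_iter s s1 s2 :
    step s s1 -> while_loop step s1 s2 -> while_loop step s s2.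

Fixpoint for_loop (I S : Type) (body : I -> S -> S -> Prop) (r : seq I)
    (s s' : S) : Prop :=
  if r is i :: r' then exists2 s1, body i s s1 & for_loop body r' s1 s'
  else s' = s.

Definition downto0 (m : nat) : seq 'I_m := rev (enum 'I_m).

Definition index_submx (K : Type) (m n : nat) (A : 'M[K]_(m, n))
    (sigma : seq 'I_m) (tau : seq 'I_n) : 'M[K]_(size sigma, size tau) :=
  mxsub (tnth (in_tuple sigma)) (tnth (in_tuple tau)) A.

(* A_{sigma, n}, with all the columns. *)
Definition index_rows (K : Type) (m n : nat) (A : 'M[K]_(m, n))
    (sigma : seq 'I_m) : 'M[K]_(size sigma, n) :=
  rowsub (tnth (in_tuple sigma)) A.

Definition leading_at (K : fieldType) (n : nat) (v : 'rV[K]_n) (k : 'I_n) :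
    bool :=
  (v 0 k != 0) && [forall k' : 'I_n, (k' < k)%N ==> (v 0 k' == 0)].

(* row_i(A) <- row_i(A) - lambda row_j(A) *)
Definition sub_row (K : fieldType) (m n : nat) (i j : 'I_m) (lambda : K)
    (A : 'M[K]_(m, n)) : 'M[K]_(m, n) :=
  \matrix_(a, b) if a == i then A i b - lambda * A j b else A a b.

Definition set_entry (K : Type) (m n : nat) (i : 'I_m) (k : 'I_n) (x : K)
    (A : 'M[K]_(m, n)) : 'M[K]_(m, n) :=
  \matrix_(a, b) if (a == i) && (b == k) then x else A a b.

(* Algorithm I; a state is a pair (B, L).                                     *)

Definition step1 (K : fieldType) (m n : nat) (i : 'I_m)
    (s s' : 'M[K]_(m, n) * 'M[K]_m) : Prop :=
  exists (j : 'I_m) (k : 'I_n),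
    let: (B, L) := s in
    let lambda := B i k / B j k in
    [/\ (i < j)%N, leading_at (row i B) k, leading_at (row j B) k
      & s' = (sub_row i j lambda B, sub_row i j lambda L)].

(* Algorithm I on input D terminates with working copy B and returns L.       *)
Definition algorithm1 (K : fieldType) (m n : nat) (D : 'M[K]_(m, n))
    (B : 'M[K]_(m, n)) (L : 'M[K]_m) : Prop :=
  for_loop (fun i => while_loop (step1 i)) (downto0 m) (D, 1%:M) (B, L).

Definition pivot_rows (K : fieldType) (m n : nat) (B : 'M[K]_(m, n)) :
    seq 'I_m :=
  [seq i <- enum 'I_m | row i B != 0].

Record state2 (K : fieldType) (m n : nat) := State2 {
  ind : seq 'I_m;
  Rbar : 'M[K]_(size ind);
  piv : 'M[K]_(m, n)  (* the matrix M *)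
}.

(* The inner loop acts on (v, w); [st] is the outer state. *)
Definition step2 (K : fieldType) (m n : nat) (D : 'M[K]_(m, n))
    (st : state2 K m n)
    (s s' : 'rV[K]_(size (ind st)) * 'rV[K]_n) : Prop :=
  exists (k : 'I_n) (l : 'I_(size (ind st))),
    let: (v, w) := s in
    let j := tnth (in_tuple (ind st)) l in
    let lambda := w 0 k / piv st j k in
    [/\ leading_at w k, piv st j k != 0
      & s' = (v - lambda *: row l (Rbar st),
              w - lambda *: (row l (Rbar st) *m index_rows D (ind st)))].

(* The block matrix has size 1 + size (ind st), which is convertible to       *)
(* size (i :: ind st).                                                        *)
Definition body2 (K : fieldType) (m n : nat) (D : 'M[K]_(m, n)) (i : 'I_m)
    (st st' : state2 K m n) : Prop :=
  exists (v : 'rV[K]_(size (ind st))) (w : 'rV[K]_n),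
    while_loop (@step2 K m n D st) (0, row i D) (v, w) /\
    if w == 0 then st' = st
    else exists2 k, leading_at w k &
      st' = @State2 K m n (i :: ind st)
              (block_mx (1%:M : 'M[K]_1) v 0 (Rbar st))
              (set_entry i k (w 0 k) (piv st)).

(* Algorithm II on input D terminates in the state st, whose components Rbar  *)
(* and piv are the returned matrices.                                         *)
Definition algorithm2 (K : fieldType) (m n : nat) (D : 'M[K]_(m, n))
    (st : state2 K m n) : Prop :=
  for_loop (body2 D) (downto0 m) (@State2 K m n [::] 0 0) st.

(* Both algorithms have a terminating run on every input.                     *)

Lemma while_loop_total (S : Type) (step : S -> S -> Prop) (I : S -> Prop)
    (mu : S -> nat) :
  (forall s, I s -> (exists s', step s s') \/ (forall s', ~ step s s')) ->
  (forall s s', I s -> step s s' -> I s' /\ (mu s' < mu s)%N) ->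
  forall s, I s -> exists2 s', while_loop step s s' & I s'.
Proof.
move=> dec decr s; have [N] := ubnP (mu s); elim: N s => // N IH s sN Is.
case: (dec s Is) => [[s1 st]|no]; last by exists s => //; exact: while_exit.
have [Is1 lt1] := decr _ _ Is st.
have [|s2 w2 I2] := IH s1 _ Is1; first by apply: leq_trans lt1 _; rewrite -ltnS.
by exists s2 => //; apply: while_iter st w2.
Qed.

Lemma for_loop_total (I S : Type) (body : I -> S -> S -> Prop) (r : seq I) :
  (forall i s, exists s', body i s s') ->
  forall s, exists s', for_loop body r s s'.
Proof.
move=> tot; elim: r => [|i r IH] s; first by exists s.
by have [s1 b1] := tot i s; have [s2 f2] := IH s1; exists s2, s1.
Qed.

Lemma leading_ex (K : fieldType) (n : nat) (v : 'rV[K]_n) :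
  v != 0 -> exists k, leading_at v k.
Proof.
move=> v0; have [k0 vk0] : exists k, v 0 k != 0.
  by case/rV0Pn: v0 => k vk; exists k.
case: (@arg_minnP _ k0 (fun k => v 0 k != 0) (fun k : 'I_n => k : nat) vk0) => k vk kmin; exists k.
rewrite /leading_at vk; apply/forallP => k'; apply/implyP => lt.
by apply/negPn/negP => /kmin; rewrite leqNgt lt.
Qed.

(* The number of entries of v from its leading entry on. *)
Definition remaining (K : fieldType) (n : nat) (v : 'rV[K]_n) : nat :=
  \max_(k | v 0 k != 0) (n - k)%N.

Lemma remaining_lt (K : fieldType) (n : nat) (v u : 'rV[K]_n) (k : 'I_n) :
  leading_at v k -> leading_at u k ->
  (remaining (v - (v 0 k / u 0 k) *: u)%R < remaining v)%N.
Proof.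
case/andP=> vk /forallP vz /andP[uk /forallP uz].
apply: (@leq_trans (n - k)); last exact: (leq_bigmax_cond k vk).
have nk : (0 < n - k)%N by rewrite subn_gt0.
suff : (remaining (v - (v 0 k / u 0 k) *: u)%R <= (n - k).-1)%N by lia.
apply/bigmax_leqP => a; rewrite !mxE => va.
suff : (k < a)%N by have := ltn_ord a; lia.
rewrite ltnNge; apply/negP; rewrite leq_eqVlt => /orP[/eqP/val_inj e|lt].
  by case/eqP: va; rewrite e mulfVK // subrr.
case/eqP: va; have /eqP -> := implyP (vz a) lt.
by have /eqP -> := implyP (uz a) lt; rewrite mulr0 subr0.
Qed.

Lemma algorithm1_total (K : fieldType) (m n : nat) (D : 'M[K]_(m, n)) :
  exists (B : 'M[K]_(m, n)) (L : 'M[K]_m), algorithm1 D B L.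
Proof.
suff [[B L] ?] : exists s,
  for_loop (fun i => while_loop (@step1 K m n i)) (downto0 m) (D, 1%:M) s.
  by exists B, L.
apply: for_loop_total => i s.
have [] := @while_loop_total _ (@step1 K m n i) (fun _ => True)
  (fun s => remaining (row i s.1)) _ _ s I; last by move=> s' ? _; exists s'.
- move=> [B L] _; case: (boolP [exists j : 'I_m, exists k : 'I_n,
    [&& (i < j)%N, leading_at (row i B) k & leading_at (row j B) k]]).
  + by case/existsP=> j /existsP[k /and3P[? ? ?]]; left; eexists; exists j, k.
  + move/negP=> no; right=> s' [j [k [? ? ? _]]]; apply: no.
    by apply/existsP; exists j; apply/existsP; exists k; apply/and3P.
- move=> [B L] _ _ [j [k [ij Li Lj ->]]] /=; split=> //.
  have := remaining_lt Li Lj; rewrite !mxE; congr (remaining _ < _)%N.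
  by apply/rowP => b; rewrite !mxE eqxx.
Qed.

Lemma algorithm2_total (K : fieldType) (m n : nat) (D : 'M[K]_(m, n)) :
  exists st : state2 K m n, algorithm2 D st.
Proof.
pose inv (st : state2 K m n) :=
  (forall i k, i \notin ind st -> piv st i k = 0) /\
  forall l k,
  piv st (tnth (in_tuple (ind st)) l) k != 0 ->
  let u := row l (Rbar st) *m index_rows D (ind st) in
  leading_at u k /\ u 0 k = piv st (tnth (in_tuple (ind st)) l) k.
suff main r st : uniq r -> (forall i, i \in r -> i \notin ind st) -> inv st ->
    exists st', for_loop (body2 D) r st st'.
  apply: main => //; first by rewrite rev_uniq enum_uniq.
  by split=> [i k _|[]] //; rewrite mxE.
elim: r st => [|i r IH] st; first by move=> *; exists st.
case/andP=> ir ur notin [pz ist].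
have ii : i \notin ind st by apply: notin; rewrite mem_head.
have [] := @while_loop_total _ (@step2 K m n D st)
  (fun s => s.2 = row i D + s.1 *m index_rows D (ind st))
  (fun s => remaining s.2) _ _ (0, row i D).
- move=> [v w] _; case: (boolP [exists k : 'I_n, exists l,
    leading_at w k && (piv st (tnth (in_tuple (ind st)) l) k != 0)]).
  + by case/existsP=> k /existsP[l /andP[? ?]]; left; eexists; exists k, l.
  + move/negP=> no; right=> s' [k [l [? ? _]]]; apply: no.
    by apply/existsP; exists k; apply/existsP; exists l; apply/andP.
- move=> [v w] _ /= ew [k [l [Lw pk ->]]] /=; split.
    by rewrite mulmxBl -scalemxAl ew addrA.
  have [Lu <-] := ist l k pk; exact: remaining_lt.
- by rewrite /= mul0mx addr0.
move=> [v w] run /= ew.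
have notin' j : j \in r -> j \notin ind st.
  by move=> jr; apply: notin; rewrite inE jr orbT.
have [w0|w0] := eqVneq w 0.
  have [st' f'] := IH st ur notin' (conj pz ist); exists st', st => //.
  by exists v, w; split=> //; rewrite w0 eqxx.
have [k Lk] := leading_ex w0.
pose st1 := @State2 K m n (i :: ind st)
  (block_mx (1%:M : 'M[K]_1) v 0 (Rbar st)) (set_entry i k (w 0 k) (piv st)).
suff [st' f'] : exists st', for_loop (body2 D) r st1 st'.
  exists st', st1 => //; exists v, w; split=> //.
  by rewrite (negPf w0); exists k.
apply: IH => //.
  move=> j jr; rewrite inE negb_or notin' // andbT.
  by apply: contraNneq ir => <-.
pose X := index_rows D (ind st).
have rowsE (l : 'I_(1 + size (ind st))) :
    @row K (size (ind st1)) _ l (Rbar st1) *m index_rows D (ind st1) =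
    row l (col_mx w (Rbar st *m X)).
  have -> : index_rows D (ind st1) = col_mx (row i D) X :> 'M_(1 + _, _).
    apply/matrixP => a b; rewrite !mxE.
    case: splitP => a' ea.
      by rewrite mxE (tnth_nth i) ea ord1.
    by rewrite mxE !(tnth_nth i) /= ea.
  rewrite -row_mul; congr (@row K (size (ind st1)) _ l _); rewrite ew.
  have := mul_block_col (1%:M : 'M[K]_1) v 0 (Rbar st) (row i D) X.
  by rewrite mul1mx mul0mx add0r.
have tailE (l : 'I_(size (ind st))) : tnth (in_tuple (ind st)) l == i = false.
  by apply: contraNF ii => /eqP <-; rewrite mem_tnth.
split=> [j k'|l k'].
  by rewrite inE negb_or => /andP[/negPf ji jn]; rewrite mxE ji pz.
cbv zeta; rewrite (rowsE l).
have [l' ->|l' ->] := @split_ordP 1 (size (ind st)) l.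
  rewrite rowKu ord1 row_id; rewrite (_ : tnth _ _ = i) //.
  rewrite /= !mxE eqxx /=; case: (eqVneq k' k) => [-> //|kk'].
  by rewrite (pz _ _ ii) eqxx.
rewrite rowKd row_mul (_ : tnth _ _ = tnth (in_tuple (ind st)) l').
  have -> : piv st1 (tnth (in_tuple (ind st)) l') k' =
      piv st (tnth (in_tuple (ind st)) l') k' by rewrite mxE tailE.
  exact: ist.
by rewrite !(tnth_nth i).
Qed.

(* Main.v *)
Require Import Defs.
From mathcomp Require Import all_boot all_order all_algebra.

(** The two algorithms run in lockstep.  Rows already processed by Algorithm I
    have pairwise distinct leading columns, so in each inner loop the row [j]
    used for the next reduction is forced, and it is a row that Algorithm II
    has stored.  The matrix [M] records exactly the leading entries of the
    processed rows, and a row of [Rbar], spread out over the columns [ind], is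
    the corresponding row of [L]. *)

Set Implicit Arguments.
Unset Strict Implicit.
Unset Printing Implicit Defensive.

Import GRing.Theory.
Local Open Scope ring_scope.

(** * Simultaneous runs of two nondeterministic loops *)

(** The first two hypotheses make the loops stop together. Both runs are given and choose
    independently, so the relation must survive every pair of steps, not merely some matching
    pair. *)
Lemma while_loop_bisim (S T : Type) (step : S -> S -> Prop)
    (step' : T -> T -> Prop) (sim : S -> T -> Prop) :
  (forall s t s1, sim s t -> step s s1 -> exists t1, step' t t1) ->
  (forall s t t1, sim s t -> step' t t1 -> exists s1, step s s1) ->
  (forall s t s1 t1, sim s t -> step s s1 -> step' t t1 -> sim s1 t1) ->
  forall s s1 t t1, while_loop step s s1 -> while_loop step' t t1 ->
  sim s t -> sim s1 t1.
Proof.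
move=> forth back simS s s1 t t1 run; elim: run t => {s s1}.
- move=> s stop t run; case: run => {t t1} // t t2 t1 st _ sim_st.
  by have [s1 /stop] := back _ _ _ sim_st st.
- move=> s s1 s2 st _ IH t run; case: run IH => {t t1} [t stop|t t2 t1 st' run] IH sim_st.
    by have [t1 /stop] := forth _ _ _ sim_st st.
  by apply: IH run _; apply: simS sim_st st st'.
Qed.

Lemma while_loop_stop (S : Type) (step : S -> S -> Prop) s s' :
  while_loop step s s' -> forall s1, ~ step s' s1.
Proof. by elim. Qed.

(** * Leading entries, compressed matrices and row operations *)

Lemma leading_at_inj (K : fieldType) (n : nat) (v : 'rV[K]_n) (k k' : 'I_n) :
  leading_at v k -> leading_at v k' -> k = k'.
Proof.
case/andP=> vk /forallP zk /andP[vk' /forallP zk'].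
apply/val_inj; case: (ltngtP k k') => // lt.
  by move: vk; rewrite (eqP (implyP (zk' k) lt)) eqxx.
by move: vk'; rewrite (eqP (implyP (zk k') lt)) eqxx.
Qed.

Lemma leading_at_neq0 (K : fieldType) (n : nat) (v : 'rV[K]_n) (k : 'I_n) :
  leading_at v k -> v != 0.
Proof. by case/andP=> vk _; apply: contraNneq vk => ->; rewrite mxE. Qed.

Lemma index_rows_mul (K : fieldType) (m p n : nat) (A : 'M[K]_(m, p))
    (X : 'M[K]_(p, n)) (sigma : seq 'I_m) :
  index_rows A sigma *m X = index_rows (A *m X) sigma.
Proof. by apply/matrixP => a b; rewrite !mxE; apply: eq_bigr => c _; rewrite mxE. Qed.

Lemma index_rows_cons (K : fieldType) (m n : nat) (A : 'M[K]_(m, n))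
    (i : 'I_m) (sigma : seq 'I_m) :
  index_rows A (i :: sigma) =
  col_mx (row i A) (index_rows A sigma) :> 'M_(1 + size sigma, n).
Proof.
apply/matrixP => a b; rewrite !mxE; case: splitP => a' ea.
  by rewrite mxE (tnth_nth i) ea ord1.
by rewrite mxE !(tnth_nth i) /= ea.
Qed.

(* Multiplying by [index_rows 1%:M sigma] scatters the columns of a compressed
   matrix to the positions [sigma]; reading these positions inverts it. *)
Lemma mul_index_rows1_tnth (K : fieldType) (m p : nat) (sigma : seq 'I_m)
    (A : 'M[K]_(p, size sigma)) (a : 'I_p) (l : 'I_(size sigma)) :
  uniq sigma ->
  (A *m index_rows 1%:M sigma) a (tnth (in_tuple sigma) l) = A a l.
Proof.
move=> us; rewrite mxE (bigD1 l) //= !mxE eqxx mulr1 big1 ?addr0 // => l' ll'.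
rewrite !mxE (tnth_nth (tnth (in_tuple sigma) l)).
rewrite [X in _ == X](tnth_nth (tnth (in_tuple sigma) l)) /= nth_uniq //.
by rewrite -[_ == _]/(l' == l) (negPf ll') mulr0.
Qed.

Lemma row_sub_row (K : fieldType) (m n : nat) (i j a : 'I_m) (c : K)
    (A : 'M[K]_(m, n)) :
  row a (sub_row i j c A) = if a == i then row i A - c *: row j A else row a A.
Proof. by apply/rowP => b; rewrite mxE mxE; case: ifP => _; rewrite !mxE. Qed.

(** A row operation acts from the left, so it commutes with a right factor; this preserves
    [B = L *m D]. *)
Lemma sub_row_mul (K : fieldType) (m p n : nat) (i j : 'I_m) (c : K)
    (A : 'M[K]_(m, p)) (X : 'M[K]_(p, n)) :
  sub_row i j c A *m X = sub_row i j c (A *m X).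
Proof.
apply/row_matrixP => a; rewrite row_mul !row_sub_row.
by case: ifP => _; rewrite ?mulmxBl -?scalemxAl !row_mul.
Qed.

(** * Invariants coupling the two algorithms *)

Section Lockstep.
Variables (K : fieldType) (m n : nat) (D : 'M[K]_(m, n)).
Implicit Types (r : seq 'I_m) (B : 'M[K]_(m, n)) (L : 'M[K]_m).
Implicit Types st : state2 K m n.

(* Outer loop invariant; [r] lists the rows still to be processed. *)
Record lockstep r B L st : Prop := Lockstep {
  ls_mul : B = L *m D;
  ls_todo : forall i, i \in r -> row i L = row i 1%:M;
  ls_sorted : sorted ltn (map val (ind st));
  ls_ind : forall a, (a \in ind st) = (a \notin r) && (row a B != 0);
  ls_row : forall l : 'I_(size (ind st)),
    row (tnth (in_tuple (ind st)) l) L =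
    row l (Rbar st) *m index_rows 1%:M (ind st);
  ls_piv : forall j k, piv st j k =
    if (j \notin r) && leading_at (row j B) k then B j k else 0;
  ls_inj : forall j j' k, j \notin r -> j' \notin r ->
    leading_at (row j B) k -> leading_at (row j' B) k -> j = j'
}.

(* Inner loop invariant; [L0] is the value of [L] before row [i] is treated. *)
Record inner_lockstep (i : 'I_m) L0 (sigma : seq 'I_m)
    (s : 'M[K]_(m, n) * 'M[K]_m)
    (t : 'rV[K]_(size sigma) * 'rV[K]_n) : Prop := InnerLockstep {
  ils_mul : s.1 = s.2 *m D;
  ils_other : forall j, j != i -> row j s.2 = row j L0;
  ils_row : row i s.2 = row i 1%:M + t.1 *m index_rows 1%:M sigma;
  ils_w : t.2 = row i s.1
}.

(** Translates the guard of Algorithm II on stored entries into the condition on leading columns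
    used by Algorithm I. *)
Lemma ls_pivP r B L st j k : lockstep r B L st ->
  (piv st j k != 0) = (j \notin r) && leading_at (row j B) k.
Proof.
move=> ls; rewrite (ls_piv ls); case: ifP => [/andP[_ /andP[]]|]; last by rewrite eqxx.
by rewrite mxE => ->.
Qed.

(** The inner invariant freezes only rows of [L]; those of [B] follow from [B = L *m D]. *)
Lemma ils_rowB i B L st r s t j : lockstep r B L st ->
  @inner_lockstep i L (ind st) s t -> j != i -> row j s.1 = row j B.
Proof.
by move=> ls ils ji; rewrite (ils_mul ils) (ls_mul ls) !row_mul (ils_other ils).
Qed.

Lemma inner_lockstep_run i r B L st s t :
  lockstep (i :: r) B L st ->
  (forall a, (a \in i :: r) = (a <= i)%N) ->
  while_loop (step1 i) (B, L) s ->
  while_loop (@step2 K m n D st) (0, row i D) t ->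
  @inner_lockstep i L (ind st) s t.
Proof.
move=> ls rE run1 run2.
have gt_neq (j : 'I_m) : (i < j)%N -> j != i.
  by move=> ij; apply: contraTneq ij => ->; rewrite ltnn.
apply: (while_loop_bisim _ _ _ run1 run2).
(* A reducing row [j] is processed and nonzero, hence listed in [ind]. *)
- move=> [B1 L1] [v w] _ ils [j [k [ij Li Lj _]]]; have /= ew := ils_w ils.
  have Lj' : leading_at (row j B) k by rewrite -(ils_rowB ls ils) ?gt_neq.
  have jn : j \notin i :: r by rewrite rE -ltnNge.
  have /tnthP [l el] : j \in in_tuple (ind st).
    by rewrite (ls_ind ls) jn (leading_at_neq0 Lj').
  eexists; exists k, l; split=> //; first by rewrite ew.
  by rewrite -el (ls_pivP _ _ ls) jn.
- move=> [B1 L1] [v w] _ ils [k [l [Lw pk _]]]; have /= ew := ils_w ils.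
  move: pk; rewrite (ls_pivP _ _ ls); set j := tnth _ _ => /andP[].
  rewrite rE -ltnNge => ij Lj.
  eexists; exists j, k; split=> //; first by rewrite -ew.
  by rewrite (ils_rowB ls ils) ?gt_neq.
- move=> [B1 L1] [v w] _ _ ils [j [k [ij Li Lj ->]]] [k' [l [Lw pk ->]]].
  have ji := gt_neq _ ij; have /= eW := ils_w ils.
  have e : k = k' by apply: leading_at_inj Li _; rewrite -eW.
  subst k'.
  move: pk; rewrite (ls_pivP _ _ ls) => pk.
  (* The column fixes the row, as processed rows have distinct leading columns. *)
  have ej : j = tnth (in_tuple (ind st)) l.
    case/andP: pk => ln Ll; apply: (ls_inj ls) Ll => //.
      by rewrite rE -ltnNge.
    by rewrite -(ils_rowB ls ils).
  have rowB := ils_rowB ls ils ji.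
  have eB : B1 j k = B j k by have /rowP/(_ k) := rowB; rewrite !mxE.
  have ew : w 0 k = B1 i k by rewrite eW !mxE.
  rewrite (ls_piv ls) pk -ej -eB ew.
  have eR : row l (Rbar st) *m index_rows 1%:M (ind st) = row j L.
    by rewrite -(ls_row ls) -ej.
  split=> /=.
  + by rewrite sub_row_mul -(ils_mul ils).
  + by move=> a ai; rewrite row_sub_row (negPf ai) (ils_other ils).
  + rewrite row_sub_row eqxx (ils_row ils) (ils_other ils ji) /=.
    by rewrite mulmxBl -scalemxAl eR addrA.
  (* The row that Algorithm II subtracts, before scaling, is row [j] of [L] times [D], that is, row
     [j] of [B]. *)
  + rewrite row_sub_row eqxx -eW rowB (ls_mul ls) row_mul -eR.
    by rewrite -mulmxA index_rows_mul mul1mx.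
- split=> //=; first exact: ls_mul ls.
  + by rewrite (ls_todo ls) ?mem_head // mul0mx addr0.
  + by rewrite (ls_mul ls) row_mul (ls_todo ls) ?mem_head // -row_mul mul1mx.
Qed.

Lemma lockstep_body i r B L st B1 L1 st1 :
  lockstep (i :: r) B L st -> i \notin r ->
  (forall a, (a \in i :: r) = (a <= i)%N) ->
  while_loop (step1 i) (B, L) (B1, L1) -> body2 D i st st1 ->
  lockstep r B1 L1 st1.
Proof.
move=> ls ir rE run1 [v [w [run2 fin]]].
have ils := inner_lockstep_run ls rE run1 run2.
have stop := while_loop_stop run1.
have /= eB := ils_rowB ls ils.
have /= eL := ils_other ils.
have /= ew := ils_w ils.
have /= eM := ils_mul ils.
have neq a : a \in r -> a != i by move=> ar; apply: contraNneq ir => <-.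
have notin a : a != i -> a \notin r -> a \notin i :: r.
  by move=> ai ar; rewrite inE negb_or ai.
have todo a : a \in r -> row a L1 = row a 1%:M.
  by move=> ar; rewrite eL ?neq // (ls_todo ls) // inE ar orbT.
have ii : i \notin ind st by rewrite (ls_ind ls) mem_head.
have ind_neq a : a \in ind st -> a != i by apply: contraTneq => ->.
have inj j j' k : j \notin r -> j' \notin r ->
    leading_at (row j B1) k -> leading_at (row j' B1) k -> j = j'.
  (* At the exit of the inner loop no processed row shares its leading column with row [i]. *)
  have no_i a : a != i -> a \notin r -> leading_at (row i B1) k ->
      ~ leading_at (row a B1) k.
    move=> ai ar Li La; apply: (stop (_, _)); exists a, k; split=> //.
    by have := notin _ ai ar; rewrite rE -ltnNge.
  have [->|ji] := eqVneq j i; have [->|j'i] := eqVneq j' i => //.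
  - by move=> _ j'r Li /(no_i _ j'i j'r Li).
  - by move=> jr _ Lj Li; case: (no_i _ ji jr Li Lj).
  - by move=> jr j'r; rewrite !eB //; apply: (ls_inj ls); apply: notin.
have [w0|w0] := eqVneq w 0.
  move: fin; rewrite w0 eqxx => ->; split=> //.
  - exact: ls_sorted ls.
  - move=> a; rewrite (ls_ind ls) inE negb_or.
    have [->|ai] := eqVneq a i; last by rewrite eB.
    by rewrite -ew w0 eqxx andbF.
  - by move=> l; rewrite eL ?ind_neq ?mem_tnth // (ls_row ls).
  - move=> j k; rewrite (ls_piv ls) inE negb_or.
    have [->|ji] := eqVneq j i; last first.
      by rewrite eB //; have /rowP/(_ k) := eB _ ji; rewrite !mxE => ->.
    rewrite -ew w0 /=; case: ifP => // /andP[_ /leading_at_neq0].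
    by rewrite eqxx.
move: fin; rewrite (negPf w0) => -[k Lk ->]; split=> //=.
- rewrite path_sortedE; last exact: ltn_trans.
  rewrite (ls_sorted ls) andbT; apply/allP => _ /mapP[a ai ->] /=.
  by move: ai; rewrite (ls_ind ls) rE -ltnNge => /andP[].
- move=> a; rewrite inE (ls_ind ls) inE negb_or.
  have [->|ai] := eqVneq a i; first by rewrite ir -ew w0.
  by rewrite eB.
(* Scattering [[1 v]] over [i :: ind st] gives [row i 1%:M + v *m E], which is row [i] of [L1]; the
   zero block leaves the older rows unchanged. *)
- pose E := index_rows (1%:M : 'M[K]_m) (ind st).
  move=> l; rewrite index_rows_cons -row_mul.
  have -> : (block_mx (1%:M : 'M[K]_1) v 0 (Rbar st) : 'M_(1 + size (ind st)))
      *m col_mx (row i 1%:M) E = col_mx (row i L1) (Rbar st *m E).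
    by rewrite mul_block_col mul1mx mul0mx add0r (ils_row ils).
  (* The index type is replaced by the convertible ['I_(1 + size (ind st))] so that it can be
     split. *)
  suff rowsE (l0 : 'I_(1 + size (ind st))) :
      row (tnth (in_tuple (i :: ind st)) l0) L1 =
      row l0 (col_mx (row i L1) (Rbar st *m E)) by exact: rowsE.
  have [l' ->|l' ->] := split_ordP l0.
    by rewrite rowKu ord1 row_id (_ : tnth _ _ = i).
  rewrite rowKd row_mul (_ : tnth _ _ = tnth (in_tuple (ind st)) l').
    by rewrite eL ?ind_neq ?mem_tnth // (ls_row ls).
  by rewrite !(tnth_nth i).
- move=> j k'; rewrite mxE; have [->|ji] /= := eqVneq j i; last first.
    rewrite (ls_piv ls) inE negb_or ji eB //.
    by have /rowP/(_ k') := eB _ ji; rewrite !mxE => ->.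
  rewrite ir -ew /=; have [->|kk'] := eqVneq k' k.
    by rewrite Lk ew mxE.
  (* The old entry is zero because row [i] was unprocessed, and the leading column is unique. *)
  rewrite (ls_piv ls) mem_head /=; case: ifP => // Lk'.
  by rewrite (leading_at_inj Lk Lk') eqxx in kk'.
Qed.

(** A decreasing, downward closed list consists of all rows up to its head, so being processed means
    having a larger index than the current row, as the guard of Algorithm I asks. *)
Lemma lockstep_loop r B L st B1 L1 st1 :
  lockstep r B L st -> sorted gtn (map val r) ->
  (forall a b : 'I_m, (a <= b)%N -> b \in r -> a \in r) ->
  for_loop (fun i => while_loop (step1 i)) r (B, L) (B1, L1) ->
  for_loop (body2 D) r st st1 -> lockstep [::] B1 L1 st1.
Proof.
elim: r B L st => [|i r IH] B L st ls; first by move=> _ _ [-> ->] ->.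
move=> sr down [[B2 L2] run1 rest1] [st2 run2 rest2].
have gt_trans : transitive gtn by move=> x y z /= xy zx; apply: ltn_trans zx xy.
move: (sr); rewrite /= path_sortedE // => /andP[/allP lti srt].
have lt_i a : a \in r -> (a < i)%N by move=> ar; apply: lti; apply: map_f.
have ir : i \notin r by apply/negP => /lt_i; rewrite ltnn.
have rE a : (a \in i :: r) = (a <= i)%N.
  apply/idP/idP => [|ai]; last by apply: down ai _; rewrite mem_head.
  by rewrite inE => /predU1P[->|/lt_i/ltnW].
apply: (IH B2 L2 st2) => //; first exact: lockstep_body run1 run2.
move=> a b ab br; have := down _ _ ab; rewrite !inE br orbT => /(_ isT).
case/predU1P=> // ai; by have := lt_i _ br; rewrite ltnNge -ai ab.
Qed.

Lemma lockstep_init : lockstep (downto0 m) D 1%:M (@State2 K m n [::] 0 0).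
Proof.
have all a : a \in downto0 m by rewrite mem_rev mem_enum.
split=> //=; first by rewrite mul1mx.
- by move=> a; rewrite all.
- by case.
- by move=> j k; rewrite all mxE.
- by move=> j j' k; rewrite all.
Qed.

End Lockstep.

Theorem mainTheorem9 (K : fieldType) (m n : nat) (D : 'M[K]_(m, n))
    (B : 'M[K]_(m, n)) (Rinv : 'M[K]_m) (st : state2 K m n)
    (hI : algorithm1 D B Rinv) (hII : algorithm2 D st) :
  let rho := pivot_rows B in
  exists e : size (ind st) = size rho,
    castmx (e, e) (Rbar st) = index_submx Rinv rho rho.
Proof.
move=> rho.
have ls : lockstep D [::] B Rinv st.
  apply: lockstep_loop (lockstep_init D) _ _ hI hII.
    by rewrite map_rev rev_sorted val_enum_ord iota_ltn_sorted.
  by move=> a b _ _; rewrite mem_rev mem_enum.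
(* Both lists are strictly increasing and consist of the nonzero rows of [B]. *)
have erho : ind st = rho.
  apply: (inj_map val_inj); apply: (irr_sorted_eq ltn_trans ltnn).
  - exact: ls_sorted ls.
  - apply: (subseq_sorted ltn_trans (s2 := map val (enum 'I_m))).
      exact/map_subseq/filter_subseq.
    by rewrite val_enum_ord iota_ltn_sorted.
  - by apply: eq_mem_map => a; rewrite (ls_ind ls) mem_filter mem_enum andbT.
have us : uniq (ind st) by rewrite erho filter_uniq ?enum_uniq.
rewrite -erho; exists erefl; rewrite castmx_id; apply/matrixP => l l'.
(* Row [ind[l]] of [Rinv] is the scattered row [l] of [Rbar]; reading it at position [ind[l']]
   recovers the entry. *)
have /rowP/(_ (tnth (in_tuple (ind st)) l')) := ls_row ls l.
by rewrite mul_index_rows1_tnth // !mxE => ->.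
Qed.
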